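(* Let $0\le\theta<1$, let $P_1,P_2$ be $m\times m$ Markov matrices, $c_1,c_2\in\mathbb{R}^m$, and consider the Markov Decision Problem $$\min\ c_1^Tx_1+c_2^Tx_2\quad\text{subject to}\quad (I-\theta P_1)x_1+(I-\theta P_2)x_2=e,\quad x_1,x_2\ge 0,$$ where $x_1,x_2\in\mathbb{R}^m$, $I$ is the $m\times m$ identity matrix and $e$ is the vector of all ones. Then the simplex method with the most negative rule or the best improvement rule, started from an initial basic feasible solution, finds an optimal solution of this problem in at most $$n\left\lceil \frac{m^2}{1-\theta}\log\frac{m^2}{1-\theta}\right\rceil$$ iterations, where $n=2m$.
   Context: For $a\in\mathbb{R}$, $\lceil a\rceil$ denotes the smallest integer bigger than $a$; $\log$ is the natural logarithm. A Markov matrix here is a matrix with nonnegative entries each of whose columns sums to $1$; $\theta$ is the discount rate. The problem is a standard-form linear program $\min\{c^Tx: Ax=b,\ x\ge0\}$ with $A=[I-\theta P_1,\ I-\theta P_2]\in\mathbb{R}^{m\times n}$, $b=e$, $c=(c_1,c_2)$, $x=(x_1,x_2)$, $n=2m$. Bases and basic feasible solutions: $\mathcal{B}=\{B\subset\{1,\dots,n\} : |B|=m,\ \det(A_B)\neq 0\}$, where $A_B$ is the submatrix of columns indexed by $B$. For $B\in\mathcal{B}$ and $N=\{1,\dots,n\}-B$, the vector with $x_B=A_B^{-1}b$, $x_N=0$ is a basic feasible solution (BFS) if $x_B\ge 0$. Simplex method: the $t$-th iterate $x^t$ is the BFS of a basis $B^t\in\mathcal{B}$, with $N^t=\{1,\dots,n\}-B^t$.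 The reduced cost vector is $\bar c_{N^t}=c_{N^t}-A_{N^t}^T(A_{B^t}^{-1})^Tc_{B^t}$. If $\bar c_{N^t}\ge 0$, the current solution is optimal and the method stops. Otherwise a pivot (one iteration) is conducted: one nonbasic variable (entering variable) is chosen and increased, with the other nonbasic variables kept at zero and $x_{B^t}=A_{B^t}^{-1}b-A_{B^t}^{-1}A_{N^t}x_{N^t}$, until one basic variable (leaving variable) becomes zero; then the two variables are exchanged, giving $B^{t+1}$ and $x^{t+1}$. Most negative rule (Dantzig's rule): the entering index is $j^t_{MN}=\arg\min_{j\in N^t}\bar c_j$. Best improvement rule: the entering variable is chosen so that the objective value at the next iterate is minimum. *)

(* Defs.v *)
From HB Require Import structures.
From mathcomp Require Import all_boot all_order all_algebra.
Set Implicit Arguments.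
Unset Strict Implicit.
Unset Printing Implicit Defensive.
Import Order.TTheory GRing.Theory Num.Theory.
Local Open Scope ring_scope.

(* The linear program is min { c^T x : A x = b, x >= 0 }. *)

(* Enumerates, in increasing order, the elements of a set of m indices. *)
Definition set_index m n (B : {set 'I_n}) (hB : #|B| = m) (k : 'I_m) : 'I_n :=
  enum_val (cast_ord (esym hB) k).

Record basis (F : fieldType) m n (A : 'M[F]_(m, n)) := Basis {
  bset : {set 'I_n};
  bcard : #|bset| = m;
  bdet : \det (colsub (set_index bcard) A) != 0
}.

Definition bidx (F : fieldType) m n (A : 'M[F]_(m, n)) (B : basis A) :
    'I_m -> 'I_n :=
  set_index (bcard B).

(* A_B *)
Definition bmx (F : fieldType) m n (A : 'M[F]_(m, n)) (B : basis A) : 'M[F]_m :=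
  colsub (bidx B) A.

(* The vector x with x_B = A_B^-1 b and x_N = 0: the sum has one term when j is
   in B and is empty when j is in N. *)
Definition basic_sol (F : fieldType) m n (A : 'M[F]_(m, n)) (b : 'cV[F]_m)
    (B : basis A) : 'cV[F]_n :=
  \col_j \sum_(k < m | bidx B k == j) (invmx (bmx B) *m b) k 0.

(* The rows with index in N form the reduced cost vector
   c_N - A_N^T (A_B^-1)^T c_B; the other rows are zero. *)
Definition reduced_cost (F : fieldType) m n (A : 'M[F]_(m, n)) (c : 'cV[F]_n)
    (B : basis A) : 'cV[F]_n :=
  c - A^T *m (invmx (bmx B))^T *m rowsub (bidx B) c.

Definition objective (F : fieldType) n (c x : 'cV[F]_n) : F :=
  \sum_j c j 0 * x j 0.

Definition feasible (R : realFieldType) m n (A : 'M[R]_(m, n)) (b : 'cV[R]_m)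
    (x : 'cV[R]_n) : Prop :=
  A *m x = b /\ forall j, 0 <= x j 0.

Definition optimal (R : realFieldType) m n (A : 'M[R]_(m, n)) (b : 'cV[R]_m)
    (c x : 'cV[R]_n) : Prop :=
  feasible A b x /\ forall y, feasible A b y -> objective c x <= objective c y.

Definition bfs_basis (R : realFieldType) m n (A : 'M[R]_(m, n)) (b : 'cV[R]_m)
    (B : basis A) : Prop :=
  forall j, 0 <= basic_sol b B j 0.

Definition stopped (R : realFieldType) m n (A : 'M[R]_(m, n)) (c : 'cV[R]_n)
    (B : basis A) : Prop :=
  forall j, j \notin bset B -> 0 <= reduced_cost c B j 0.

(* x_B = A_B^-1 b - A_B^-1 A_N x_N when the nonbasic variable j has value s and
   the other nonbasic variables are zero. *)
Definition basic_vars (F : fieldType) m n (A : 'M[F]_(m, n)) (b : 'cV[F]_m)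
    (B : basis A) (j : 'I_n) (s : F) : 'cV[F]_m :=
  invmx (bmx B) *m b - invmx (bmx B) *m (s *: col j A).

(* The entering variable j is increased to s; the leaving variable bidx B k is
   zero there and would turn negative on any further increase. *)
Definition pivot (R : realFieldType) m n (A : 'M[R]_(m, n)) (b : 'cV[R]_m)
    (B : basis A) (j : 'I_n) (B' : basis A) : Prop :=
  j \notin bset B /\
  exists (k : 'I_m) (s : R),
    [/\ 0 <= s,
        forall i, 0 <= basic_vars b B j s i 0,
        basic_vars b B j s k 0 = 0,
        forall s', s < s' -> basic_vars b B j s' k 0 < 0
      & bset B' = j |: (bset B :\ bidx B k)].

Inductive pivot_rule := MostNegative | BestImprovement.

(* [entering rule b c B j B'] : the rule selects the entering variable j at B,
   where B' is the next basis. Ties may be broken arbitrarily. *)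
Definition entering (R : realFieldType) m n (A : 'M[R]_(m, n))
    (rule : pivot_rule) (b : 'cV[R]_m) (c : 'cV[R]_n)
    (B : basis A) (j : 'I_n) (B' : basis A) : Prop :=
  match rule with
  | MostNegative =>
      forall j', j' \notin bset B ->
        reduced_cost c B j 0 <= reduced_cost c B j' 0
  | BestImprovement =>
      forall j' (B'' : basis A), pivot b B j' B'' ->
        objective c (basic_sol b B') <= objective c (basic_sol b B'')
  end.

Definition simplex_step (R : realFieldType) m n (A : 'M[R]_(m, n))
    (rule : pivot_rule) (b : 'cV[R]_m) (c : 'cV[R]_n) (B B' : basis A) : Prop :=
  ~ stopped c B /\ exists j, pivot b B j B' /\ entering rule b c B j B'.

(* Bs 0, ..., Bs T are the bases of T iterations started from a BFS; the values
   of Bs beyond T are irrelevant. *)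
Definition simplex_run (R : realFieldType) m n (A : 'M[R]_(m, n))
    (rule : pivot_rule) (b : 'cV[R]_m) (c : 'cV[R]_n)
    (Bs : nat -> basis A) (T : nat) : Prop :=
  bfs_basis b (Bs 0%N) /\
  forall t, (t < T)%N -> simplex_step rule b c (Bs t) (Bs t.+1).

(* Column-stochastic. *)
Definition markov (R : realFieldType) m (P : 'M[R]_m) : Prop :=
  (forall i j, 0 <= P i j) /\ (forall j, \sum_i P i j = 1).

Definition mdp_mx (R : realFieldType) m (theta : R) (P1 P2 : 'M[R]_m) :
    'M[R]_(m, m + m) :=
  row_mx (1%:M - theta *: P1) (1%:M - theta *: P2).

(* The smallest integer strictly bigger than a. It differs from [Num.ceil] at
   the integers: for m = 1 and theta = 0 the iteration bound taken with
   [Num.ceil] would be 0, although one pivot may be needed. *)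
Definition strict_ceil (R : archiRealFieldType) (a : R) : int := Num.floor a + 1.

(* Main.v *)
Require Import Defs.
From mathcomp Require Import all_boot all_order all_algebra.
From mathcomp Require Import boolp reals sequences exp.
From mathcomp Require Import ring lra.
Import Order.TTheory GRing.Theory Num.Theory.
Local Open Scope ring_scope.

(** The argument is that of Kitahara and Mizuno: it bounds the number of pivots
    by the ratio of the largest to the smallest basic variable instead of using
    any fine structure of the linear program.

    Suppose that the entries of every feasible point sum to at most sigma and
    that every basic variable of a basic feasible solution is at least delta,
    with delta positive.  Let z be the objective and z* its minimum.

    - A pivot contracts the gap z - z* by the factor 1 - delta / sigma.  Let
      Delta be the absolute value of the most negative reduced cost.  Moving to
      any feasible point gains at most Delta * sigma, whereas the most negative
      rule raises the entering variable to at least delta and gains at least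
      Delta * delta.
      The best improvement rule gains at least as much
      ([simplex_step_decrease], [simplex_step_contraction]).

    - With the reduced costs s* >= 0 of an optimal basis, the gap at x is the
      sum of the s*_j x_j.  At a given iterate one of the m basic variables
      carries at least the fraction 1 / m of the gap.  Once the gap has shrunk
      by more than the factor m sigma / delta, this same variable cannot be
      basic, as it would contribute more than the whole gap
      ([variable_elimination]).

    - For a = m sigma / delta and L > a ln a, L pivots shrink the gap by more
      than the factor a ([pow_contraction]).  So the iterates 0, L, ..., n L
      each get a variable that is basic there and at none of the later ones
      among them.
      These n + 1 variables would be distinct, so fewer than n L + 1 pivots are
      performed ([simplex_iteration_bound]).

    For the Markov decision problem, the columns of the constraint matrix sum to
    1 - theta, so the entries of every feasible point sum to m / (1 - theta).
    Row i says that the variables of state i sum to 1 plus a nonnegative term,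
    so each of the m states has a basic variable; there are only m basic
    variables, hence exactly one per state, and it is at least 1
    ([mdp_basic_ge1]).  One can take delta = 1 and sigma = m / (1 - theta). *)

Set Implicit Arguments.
Unset Strict Implicit.
Unset Printing Implicit Defensive.

(** * Bases and basic solutions *)

Section Bases.

Variables (F : fieldType) (m n : nat) (A : 'M[F]_(m, n)).
Implicit Types (B : basis A) (b : 'cV[F]_m) (c y : 'cV[F]_n).

(** The other two fields are proofs of decidable equalities, hence irrelevant;
    this is what makes the type of bases finite. *)
Lemma bset_inj : injective (@bset F m n A).
Proof.
case=> S hS dS [S' hS' dS'] /= eqS; move: hS' dS'; rewrite -eqS => hS' dS'.
have eqh : hS = hS' by apply: eq_irrelevance.
by case: _ / eqh in dS' *; congr Basis; apply: eq_irrelevance.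
Qed.

Lemma set_index_inj (S : {set 'I_n}) (hS : #|S| = m) : injective (set_index hS).
Proof. by move=> k l /enum_val_inj/cast_ord_inj. Qed.

Lemma set_index_in (S : {set 'I_n}) (hS : #|S| = m) k : set_index hS k \in S.
Proof. exact: enum_valP. Qed.

Lemma set_index_ex (S : {set 'I_n}) (hS : #|S| = m) j :
  j \in S -> exists k, set_index hS k = j.
Proof.
move=> jS; exists (cast_ord hS (enum_rank_in jS j)).
by rewrite /set_index cast_ordK enum_rankK_in.
Qed.

Lemma bmx_unit B : bmx B \in unitmx.
Proof. by rewrite unitmxE unitfE bdet. Qed.

(** Linear independence does not depend on the order in which the columns are
    listed: this form avoids tracking the ranks of indices when a column is
    exchanged. *)
Lemma colsub_set_index_det (S : {set 'I_n}) (hS : #|S| = m) :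
  (forall u : 'rV[F]_m, (forall j, j \in S -> u *m col j A = 0) -> u = 0) ->
  \det (colsub (set_index hS) A) != 0.
Proof.
move=> free; apply/negP => /det0P[u /eqP nz uA0]; apply: nz.
apply: free => j /(set_index_ex hS)[k <-].
apply/colP => i; rewrite ord1; have /rowP/(_ k) := uA0; rewrite !mxE => uk.
by rewrite -[RHS]uk; apply: eq_bigr => l _; rewrite !mxE.
Qed.

Lemma basic_sol_bidx b B k :
  basic_sol b B (bidx B k) 0 = (invmx (bmx B) *m b) k 0.
Proof.
rewrite mxE (bigD1 k) //= big1 ?addr0 // => l /andP[/eqP].
by move/set_index_inj ->; rewrite eqxx.
Qed.

Lemma basic_sol_nonbasic b B j : j \notin bset B -> basic_sol b B j 0 = 0.
Proof.
move=> jNB; rewrite mxE big1 // => k /eqP kj.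
by rewrite -kj set_index_in in jNB.
Qed.

Lemma sum_basic B (f : 'I_n -> F) :
  (forall j, j \notin bset B -> f j = 0) -> \sum_j f j = \sum_k f (bidx B k).
Proof.
move=> f0; rewrite (bigID (mem (bset B))) /= [X in _ + X]big1 // addr0.
rewrite big_enum_val /= (reindex (cast_ord (esym (bcard B)))) //=.
by exists (cast_ord (bcard B)) => i _; rewrite ?cast_ordK ?cast_ordKV.
Qed.

Lemma mulmx_basic B y : (forall j, j \notin bset B -> y j 0 = 0) ->
  A *m y = bmx B *m rowsub (bidx B) y.
Proof.
move=> y0; apply/colP => i; rewrite !mxE (@sum_basic B).
  by apply: eq_bigr => k _; rewrite !mxE.
by move=> j /y0 ->; rewrite mulr0.
Qed.

Lemma mulmx_basic_sol b B : A *m basic_sol b B = b.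
Proof.
rewrite (@mulmx_basic B); last by move=> j; exact: basic_sol_nonbasic.
rewrite (_ : rowsub _ _ = invmx (bmx B) *m b) ?mulKVmx ?bmx_unit //.
by apply/colP => k; rewrite mxE basic_sol_bidx.
Qed.

Lemma basic_sol_unique b B y :
  A *m y = b -> (forall j, j \notin bset B -> y j 0 = 0) -> y = basic_sol b B.
Proof.
move=> Ay y0; apply/colP => j; have [|jNB] := boolP (j \in bset B); last first.
  by rewrite y0 ?basic_sol_nonbasic.
move=> /(set_index_ex (bcard B))[k <-].
rewrite -/(bidx B k) basic_sol_bidx -Ay (@mulmx_basic B) //.
by rewrite mulKmx ?bmx_unit // mxE.
Qed.

Lemma objectiveE c y : objective c y = (c^T *m y) 0 0.
Proof. by rewrite mxE; apply: eq_bigr => j _; rewrite mxE. Qed.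

Lemma reduced_cost_basic c B k : reduced_cost c B (bidx B k) 0 = 0.
Proof.
have bc : rowsub (bidx B) (reduced_cost c B) = 0.
  rewrite /reduced_cost.
  have -> : forall v : 'cV[F]_n, rowsub (bidx B) (c - v) =
      rowsub (bidx B) c - rowsub (bidx B) v.
    by move=> v; apply/colP => i; rewrite !mxE.
  rewrite -mulmxA -mul_rowsub_mx.
  rewrite (_ : rowsub _ A^T = (bmx B)^T); last by apply/matrixP => i j; rewrite !mxE.
  by rewrite mulmxA -trmx_mul mulVmx ?bmx_unit // trmx1 mul1mx subrr.
by move/colP/(_ k): bc; rewrite !mxE.
Qed.

(** On the affine space A y = b the objective and the linear form given by the
    reduced costs differ by a constant, and this form vanishes at the basic
    solution. *)
Lemma objective_sub b c B y : A *m y = b ->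
  objective c y - objective c (basic_sol b B) =
  \sum_j reduced_cost c B j 0 * y j 0.
Proof.
move=> Ay.
(* The dual solution of the basis. *)
pose u := (invmx (bmx B))^T *m rowsub (bidx B) c.
have rcE z : A *m z = b ->
    \sum_j reduced_cost c B j 0 * z j 0 = objective c z - (u^T *m b) 0 0.
  move=> <-; rewrite -/(objective _ z) !objectiveE /reduced_cost -mulmxA -/u.
  by rewrite linearB /= trmx_mul trmxK mulmxBl -mulmxA !mxE.
have : \sum_j reduced_cost c B j 0 * basic_sol b B j 0 = 0.
  rewrite (@sum_basic B); last by move=> j /basic_sol_nonbasic->; rewrite mulr0.
  by rewrite big1 // => k _; rewrite reduced_cost_basic mul0r.
rewrite rcE ?mulmx_basic_sol // => /subr0_eq ->.
by rewrite -rcE.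
Qed.

End Bases.

(** * Pivots *)

Section Pivots.

Variables (R : realFieldType) (m n : nat) (A : 'M[R]_(m, n)).
Variables (b : 'cV[R]_m) (c : 'cV[R]_n).
Implicit Types B : basis A.

Lemma bfs_feasible B : bfs_basis b B -> feasible A b (basic_sol b B).
Proof. by split=> //; exact: mulmx_basic_sol. Qed.

Lemma stopped_optimal B :
  bfs_basis b B -> stopped c B -> optimal A b c (basic_sol b B).
Proof.
move=> bfsB stB; split=> [|y [Ay y0]]; first exact: bfs_feasible.
rewrite -subr_ge0 (objective_sub c B Ay) sumr_ge0 // => j _.
have [|/stB rc0] := boolP (j \in bset B); last exact: mulr_ge0.
by move=> /(set_index_ex (bcard B))[k <-]; rewrite reduced_cost_basic mul0r.
Qed.

Lemma not_stoppedP B : ~ stopped c B ->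
  exists2 j, j \notin bset B & reduced_cost c B j 0 < 0.
Proof.
move=> nst; apply: contrapT => nex; apply: nst => j jNB.
by rewrite leNgt; apply/negP => rc0; apply: nex; exists j.
Qed.

(** The point reached when the entering variable j has value s.  It is written
    through the basic solution for the right-hand side b - s A_j, so that the
    facts on basic solutions apply to it. *)
Definition edge_point B j s : 'cV[R]_n :=
  basic_sol (b - s *: col j A) B + s *: delta_mx j 0.

Lemma mulmx_edge_point B j s : A *m edge_point B j s = b.
Proof. by rewrite mulmxDr mulmx_basic_sol -scalemxAr -colE subrK. Qed.

Lemma edge_point_basic B j s k : j \notin bset B ->
  edge_point B j s (bidx B k) 0 = basic_vars b B j s k 0.
Proof.
move=> jNB; rewrite mxE basic_sol_bidx mulmxBr /basic_vars !mxE.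
suff -> : (bidx B k == j) = false by rewrite mulr0 addr0.
by apply: contraNF jNB => /eqP <-; exact: set_index_in.
Qed.

Lemma edge_point_nonbasic B j s i : i \notin bset B ->
  edge_point B j s i 0 = s *+ (i == j).
Proof.
by move=> iNB; rewrite mxE basic_sol_nonbasic // add0r !mxE andbT mulr_natr.
Qed.

Lemma edge_point_feasible B j s : j \notin bset B -> 0 <= s ->
  (forall k, 0 <= basic_vars b B j s k 0) -> feasible A b (edge_point B j s).
Proof.
move=> jNB s0 bv0; split=> [|i]; first exact: mulmx_edge_point.
have [|iNB] := boolP (i \in bset B); last by rewrite edge_point_nonbasic ?mulrn_wge0.
by move=> /(set_index_ex (bcard B))[k <-]; rewrite -/(bidx B k) edge_point_basic.
Qed.

(** The point where the leaving variable vanishes satisfies the constraints and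
    is supported on the new basis, so it is the new basic solution. *)
Lemma pivot_bfs B j B' : pivot b B j B' ->
  [/\ j \in bset B', bfs_basis b B' &
    objective c (basic_sol b B') =
    objective c (basic_sol b B) + reduced_cost c B j 0 * basic_sol b B' j 0].
Proof.
case=> jNB [k [s [s0 bv0 bvk _ B'E]]].
have yE : edge_point B j s = basic_sol b B'.
  apply: basic_sol_unique; first exact: mulmx_edge_point.
  move=> i; rewrite B'E !inE !negb_or negb_and negbK => /andP[inj].
  case/orP=> [/eqP->|iNB]; first by rewrite edge_point_basic.
  by rewrite edge_point_nonbasic // (negbTE inj).
have [_ y0] := edge_point_feasible jNB s0 bv0.
split; first by rewrite B'E !inE eqxx.
  by move=> i; rewrite -yE.
rewrite -yE -[LHS](subrK (objective c (basic_sol b B))) addrC; congr (_ + _).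
rewrite (objective_sub c B (mulmx_edge_point B j s)) (bigD1 j) //= big1 ?addr0 //.
move=> i inj; have [|iNB] := boolP (i \in bset B).
  by move=> /(set_index_ex (bcard B))[l <-]; rewrite reduced_cost_basic mul0r.
by rewrite edge_point_nonbasic // (negbTE inj) mulr0.
Qed.

Lemma simplex_step_bfs rule B B' :
  simplex_step rule b c B B' -> bfs_basis b B'.
Proof. by move=> [_ [j [/pivot_bfs[]]]]. Qed.

Lemma simplex_run_bfs rule Bs T : simplex_run rule b c Bs T ->
  forall t, (t <= T)%N -> bfs_basis b (Bs t : basis A).
Proof.
case=> bfs0 steps; elim=> [//|t IH] ltT.
exact: simplex_step_bfs (steps t ltT).
Qed.

(** The condition is that the coordinate of column j on the basic column that it
    replaces is nonzero.  A row vector u orthogonal to the new columns is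
    orthogonal to all old basic columns but the k-th; the coordinate being
    nonzero, it is orthogonal to that one as well. *)
Lemma exchange_basis B j k : j \notin bset B ->
  (invmx (bmx B) *m col j A) k 0 != 0 ->
  exists B' : basis A, bset B' = j |: (bset B :\ bidx B k).
Proof.
move=> jNB dk; set S := _ |: _.
have kB : bidx B k \in bset B by exact: set_index_in.
have hS : #|S| = m.
  rewrite cardsU1 !inE (negbTE jNB) andbF /=.
  by have := cardsD1 (bidx B k) (bset B); rewrite kB bcard.
suff dS : \det (colsub (set_index hS) A) != 0 by exists (Basis dS).
apply: colsub_set_index_det => u uS.
have uB l : l != k -> (u *m bmx B) 0 l = 0.
  move=> lk; have := uS (bidx B l).
  rewrite !inE set_index_in andbT => /(_ _)/matrixP/(_ 0 0).
  have -> : bidx B l != bidx B k by apply: contra lk => /eqP/set_index_inj ->.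
  rewrite orbT => /(_ isT); rewrite !mxE => ul.
  by rewrite -[RHS]ul; apply: eq_bigr => i _; rewrite !mxE.
have uj : (u *m col j A) 0 0 = 0 by rewrite uS ?mxE // !inE eqxx.
have uk : (u *m bmx B) 0 k = 0.
  have : (u *m bmx B *m (invmx (bmx B) *m col j A)) 0 0 = 0.
    by rewrite -mulmxA mulKVmx ?bmx_unit.
  rewrite mxE (bigD1 k) //= big1 ?addr0; last by move=> l /uB ->; rewrite mul0r.
  by move/eqP; rewrite mulf_eq0 (negbTE dk) orbF => /eqP.
rewrite -[u](@mulmxK _ _ _ (bmx B)) ?bmx_unit //.
rewrite (_ : u *m bmx B = 0) ?mul0mx //.
apply/rowP => l; rewrite [RHS]mxE; have [->//|] := eqVneq l k; exact: uB.
Qed.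

(** If no coordinate of the direction A_B^-1 A_j were positive, the entering
    variable could grow without leaving the feasible set.  Otherwise the ratio
    test gives the leaving variable. *)
Lemma pivot_exists B j sigma : bfs_basis b B ->
  (forall y, feasible A b y -> y j 0 <= sigma) ->
  j \notin bset B -> exists B', pivot b B j B'.
Proof.
move=> bfsB bnd jNB.
pose d := invmx (bmx B) *m col j A; pose x := invmx (bmx B) *m b.
have bvE s k : basic_vars b B j s k 0 = x k 0 - s * d k 0.
  by rewrite /basic_vars -scalemxAr mxE [in X in _ + X]mxE [X in - X]mxE.
have x0 k : 0 <= x k 0 by rewrite -basic_sol_bidx.
have [k0 dk0] : exists k, 0 < d k 0.
  apply: contrapT => nex.
  have d0 k : d k 0 <= 0 by rewrite leNgt; apply/negP => dk; apply: nex; exists k.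
  (* A nonnegative value of the entering variable that exceeds sigma. *)
  have s0 : 0 <= Num.max 0 (sigma + 1) by rewrite le_max lexx.
  have /bnd : feasible A b (edge_point B j (Num.max 0 (sigma + 1))).
    apply: edge_point_feasible => // k.
    by rewrite bvE subr_ge0 (le_trans _ (x0 k)) // mulr_ge0_le0.
  rewrite edge_point_nonbasic // eqxx leNgt => /negP[].
  by rewrite lt_max ltrDl ltr01 orbT.
case: (@arg_minP _ _ _ k0 (fun k => 0 < d k 0) (fun k => x k 0 / d k 0) dk0).
move=> k dk kmin; have [B' B'E] := exchange_basis jNB (lt0r_neq0 dk).
exists B'; split=> //; exists k, (x k 0 / d k 0); split=> //.
- by rewrite divr_ge0 // ltW.
- move=> i; rewrite bvE subr_ge0; have [di|di] := ltP 0 (d i 0).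
    by rewrite -ler_pdivlMr // kmin.
  by rewrite (le_trans _ (x0 i)) // mulr_ge0_le0 // divr_ge0 // ltW.
- by rewrite bvE divfK ?subrr ?lt0r_neq0.
- by move=> s; rewrite bvE subr_lt0 ltr_pdivrMr.
Qed.

(** Bases embed in the finite type of index sets, over which the values of v are
    transported. *)
Lemma basis_argmin (P : basis A -> Prop) (v : basis A -> R) :
  (exists B, P B) -> exists2 B, P B & forall B', P B' -> v B <= v B'.
Proof.
case=> B0 PB0.
pose g (S : {set 'I_n}) :=
  if pselect (exists B : basis A, bset B = S) is left e
  then v (projT1 (cid e)) else 0.
have gE B : g (bset B) = v B.
  rewrite /g; case: pselect => [e|[]]; last by exists B.
  by case: cid => B' /= /bset_inj ->.
pose Q (S : {set 'I_n}) := `[< exists2 B : basis A, bset B = S & P B >].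
have Q0 : Q (bset B0) by apply/asboolP; exists B0.
case: (@arg_minP _ _ _ (bset B0) Q g Q0) => _ /asboolP[B <- PB] Bmin.
by exists B => // B' PB'; rewrite -!gE; apply: Bmin; apply/asboolP; exists B'.
Qed.

End Pivots.

(** * The iteration bound for bounded, uniformly nondegenerate programs *)

Section IterationBound.

Variables (R : realType) (m n : nat) (A : 'M[R]_(m, n)).
Variables (b : 'cV[R]_m) (c : 'cV[R]_n) (rule : pivot_rule) (delta sigma : R).
Hypothesis m_gt0 : (0 < m)%N.
Hypothesis delta_gt0 : 0 < delta.
Hypothesis sum_le : forall y, feasible A b y -> \sum_j y j 0 <= sigma.
Hypothesis basic_ge : forall B : basis A, bfs_basis b B ->
  forall j, j \in bset B -> delta <= basic_sol b B j 0.
Implicit Types B : basis A.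

Let z B := objective c (basic_sol b B).

Lemma feasible_le y j : feasible A b y -> y j 0 <= sigma.
Proof.
move=> fy; apply: le_trans (sum_le fy); case: fy => _ y0.
by rewrite (bigD1 j) //= lerDl sumr_ge0.
Qed.

Lemma delta_le_sigma B : bfs_basis b B -> delta <= sigma.
Proof.
move=> bfsB; have kB := set_index_in (bcard B) (Ordinal m_gt0).
by rewrite (le_trans (basic_ge bfsB kB)) // feasible_le //; exact: bfs_feasible.
Qed.

(** A nonbasic column always admits a pivot, as the feasible set is bounded; the
    best improvement rule has a choice because there are finitely many bases. *)
Lemma simplex_step_exists B : bfs_basis b B -> ~ stopped c B ->
  exists B', simplex_step rule b c B B'.
Proof.
move=> bfsB nst; have [j0 j0NB _] := not_stoppedP nst.
have pivE j : j \notin bset B -> exists B', pivot b B j B'.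
  by apply: pivot_exists bfsB _ => y; exact: feasible_le.
case: rule.
- case: (@arg_minP _ _ _ j0 (fun j => j \notin bset B)
                         (fun j => reduced_cost c B j 0) j0NB) => j jNB jmin.
  by have [B' pB'] := pivE j jNB; exists B'; split=> //; exists j.
- have [|B' [j pB'] B'min] :=
    @basis_argmin _ _ _ A (fun B' => exists j, pivot b B j B') z.
    by have [B' pB'] := pivE j0 j0NB; exists B'; exists j0.
  exists B'; split=> //; exists j; split=> // j' B'' pB''.
  by apply: B'min; exists j'.
Qed.

(** Delta is the absolute value of the most negative reduced cost, for either
    rule; best improvement is compared with a pivot on a column that attains
    it. *)
Lemma simplex_step_decrease B B' : bfs_basis b B ->
  simplex_step rule b c B B' ->
  exists2 Delta, 0 < Delta &
    z B' <= z B - Delta * delta /\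
    forall y, feasible A b y -> z B - objective c y <= Delta * sigma.
Proof.
move=> bfsB [nst [j [pB' ent]]].
have [j1 j1NB j1lt0] := not_stoppedP nst.
case: (@arg_minP _ _ _ j1 (fun j => j \notin bset B)
                       (fun j => reduced_cost c B j 0) j1NB) => j0 j0NB j0min.
have rc_lt0 : reduced_cost c B j0 0 < 0 := le_lt_trans (j0min _ j1NB) j1lt0.
have [jB' bfsB' zB'] := pivot_bfs c pB'.
exists (- reduced_cost c B j0 0); first by rewrite oppr_gt0.
split; last first.
  move=> y fy; have [Ay y0] := fy; rewrite -opprB (objective_sub c B Ay) -sumrN.
  rewrite [leRHS]mulrC.
  apply: (@le_trans _ _ ((\sum_i y i 0) * - reduced_cost c B j0 0)); last first.
    by rewrite ler_wpM2r ?sum_le // oppr_ge0 ltW.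
  rewrite mulr_suml ler_sum // => i _; rewrite mulrN lerN2 mulrC ler_wpM2r //.
  have [|iNB] := boolP (i \in bset B); last exact: j0min.
  by move=> /(set_index_ex (bcard B))[k <-]; rewrite reduced_cost_basic ltW.
rewrite mulNr opprK; move: ent; case: rule => /= ent.
- rewrite /z zB' lerD2l.
  apply: (@le_trans _ _ (reduced_cost c B j0 0 * basic_sol b B' j 0)).
    by rewrite ler_wpM2r // ent.
  by rewrite ler_wnM2l ?basic_ge // ltW.
- have [|B'' pB''] := @pivot_exists _ _ _ A b B j0 sigma bfsB _ j0NB.
    by move=> y; exact: feasible_le.
  apply: le_trans (ent _ _ pB'') _; have [jB'' bfsB'' ->] := pivot_bfs c pB''.
  by rewrite lerD2l ler_wnM2l ?basic_ge // ltW.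
Qed.

Lemma simplex_step_lt B B' : bfs_basis b B ->
  simplex_step rule b c B B' -> z B' < z B.
Proof.
move=> bfsB /(simplex_step_decrease bfsB)[D D0 [zB' _]].
by rewrite (le_lt_trans zB') // gtrDl oppr_lt0 mulr_gt0.
Qed.

Lemma simplex_step_contraction B B' y : bfs_basis b B ->
  simplex_step rule b c B B' -> feasible A b y ->
  z B' - objective c y <= (1 - delta / sigma) * (z B - objective c y).
Proof.
move=> bfsB /(simplex_step_decrease bfsB)[D D0 [zB' zB]] /zB zy.
have sigma_gt0 : 0 < sigma := lt_le_trans delta_gt0 (delta_le_sigma bfsB).
rewrite mulrBl mul1r.
have : delta / sigma * (z B - objective c y) <= D * delta.
  rewrite mulrAC ler_pdivrMr // -[leRHS]mulrA [leRHS]mulrCA.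
  by rewrite ler_wpM2l // ltW.
move: zB'; rewrite -/(z B) -/(z B'); lra.
Qed.

(** A basis of least objective among the feasible ones admits no further step,
    since a step strictly decreases the objective. *)
Lemma optimal_basis_exists B : bfs_basis b B ->
  exists2 Bopt : basis A, bfs_basis b Bopt & stopped c Bopt.
Proof.
move=> bfsB.
have [|Bo bfsBo zmin] := @basis_argmin _ _ _ A (bfs_basis b) z; first by exists B.
exists Bo => //; apply: contrapT => nst.
have [B' stepB'] := simplex_step_exists bfsBo nst.
have bfsB' := simplex_step_bfs stepB'.
by have := simplex_step_lt bfsBo stepB'; rewrite ltNge zmin.
Qed.

(** The index j maximizes the contribution of a basic variable to the gap at
    [B], so this contribution is at least the m-th part of the gap; it is at
    most sigma times the j-th reduced cost at the optimal basis.  If j were basic at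
    [B'], the gap there would be at least delta times this reduced cost. *)
Lemma variable_elimination Bopt B : stopped c Bopt -> bfs_basis b B ->
  exists2 j, j \in bset B & forall B', bfs_basis b B' ->
    (z B' - z Bopt) * (m%:R * sigma / delta) < z B - z Bopt ->
    j \notin bset B'.
Proof.
move=> stBo bfsB.
pose s j := reduced_cost c Bopt j 0.
have s0 j : 0 <= s j.
  have [|/stBo //] := boolP (j \in bset Bopt).
  by move=> /(set_index_ex (bcard Bopt))[k <-]; rewrite /s reduced_cost_basic.
have gapE B' : z B' - z Bopt = \sum_j s j * basic_sol b B' j 0.
  by rewrite objective_sub //; exact: mulmx_basic_sol.
pose w k := s (bidx B k) * basic_sol b B (bidx B k) 0.
have [k _ kmax] := @arg_maxP _ _ _ (Ordinal m_gt0) xpredT w isT.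
exists (bidx B k); first exact: set_index_in.
move=> B' bfsB'; apply: contraTN => kB'; rewrite -leNgt.
have gapB : z B - z Bopt <= m%:R * (s (bidx B k) * sigma).
  rewrite gapE (@sum_basic _ _ _ _ B); last first.
    by move=> j /basic_sol_nonbasic->; rewrite mulr0.
  apply: (@le_trans _ _ (\sum_(i < m) w k)).
    by apply: ler_sum => i _; apply: kmax.
  rewrite sumr_const card_ord -[leLHS]mulr_natl ler_wpM2l // /w ler_wpM2l //.
  by rewrite feasible_le //; exact: bfs_feasible.
have gapB' : s (bidx B k) * delta <= z B' - z Bopt.
  rewrite gapE (bigD1 (bidx B k)) //=.
  rewrite ler_wpDr //; first by rewrite sumr_ge0 // => i _; rewrite mulr_ge0.
  by rewrite ler_wpM2l // basic_ge.
apply: le_trans gapB _.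
have -> : m%:R * (s (bidx B k) * sigma) =
    s (bidx B k) * delta * (m%:R * sigma / delta).
  by field; rewrite lt0r_neq0.
rewrite ler_wpM2r // divr_ge0 ?mulr_ge0 //; last exact: ltW.
by rewrite (le_trans (ltW delta_gt0)) // (delta_le_sigma bfsB).
Qed.

(** Here delta / sigma = m / a.  Since 1 - x <= exp (- x), the power is at most
    exp (- m L / a), which is at most exp (- L / a) and so less than 1 / a. *)
Lemma pow_contraction (L : nat) : delta <= sigma ->
  let a := m%:R * sigma / delta in a * ln a < L%:R ->
  (1 - delta / sigma) ^+ L * a < 1.
Proof.
move=> les a aL.
have sigma_gt0 : 0 < sigma := lt_le_trans delta_gt0 les.
have a_gt0 : 0 < a by rewrite divr_gt0 // mulr_gt0 // ltr0n.
have x0 : 0 <= 1 - delta / sigma by rewrite subr_ge0 ler_pdivrMr // mul1r.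
rewrite -ltr_pdivlMr // mul1r.
apply: (@le_lt_trans _ _ (expR (- (delta / sigma)) ^+ L)).
  by apply: lerXn2r; rewrite ?nnegrE ?expR_ge0 // expR_ge1Dx.
rewrite -[X in _ < X^-1](@lnK _ a) // -expRN -expRM_natl ltr_expR.
rewrite mulrN ltrN2 -(ltr_pM2l a_gt0) (lt_le_trans aL) //.
have -> : a * (L%:R * (delta / sigma)) = m%:R * L%:R.
  by rewrite /a; field; rewrite !lt0r_neq0.
by rewrite ler_peMl // ler1n.
Qed.

(** Each of the n indices is eliminated for good at most once, and the iterates
    at multiples of L eliminate distinct indices. *)
Theorem simplex_iteration_bound Bs T (L : nat) :
  simplex_run rule b c (Bs : nat -> basis A) T ->
  m%:R * sigma / delta * ln (m%:R * sigma / delta) < L%:R ->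
  (T <= n * L)%N.
Proof.
move=> run aL; rewrite leqNgt; apply/negP => ltT.
have bfsT := simplex_run_bfs run; have [bfs0 steps] := run.
have [Bo bfsBo stBo] := optimal_basis_exists bfs0.
have fBo := bfs_feasible bfsBo.
have les := delta_le_sigma bfs0.
have sigma_gt0 : 0 < sigma := lt_le_trans delta_gt0 les.
pose g t := z (Bs t) - z Bo.
have zge B : bfs_basis b B -> z Bo <= z B.
  by move=> /bfs_feasible; apply: (stopped_optimal bfsBo stBo).2.
have g_gt0 t : (t < T)%N -> 0 < g t.
  move=> lt; rewrite subr_gt0 (le_lt_trans (zge _ (bfsT _ lt))) //.
  exact: simplex_step_lt (bfsT _ (ltnW lt)) (steps _ lt).
have gS t : (t < T)%N -> g t.+1 <= (1 - delta / sigma) * g t.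
  move=> lt; exact: simplex_step_contraction (bfsT _ (ltnW lt)) (steps _ lt) fBo.
have q0 : 0 <= 1 - delta / sigma by rewrite subr_ge0 ler_pdivrMr // mul1r.
have q1 : 1 - delta / sigma <= 1 by rewrite gerBl divr_ge0 // ltW.
have gD t l : (t + l <= T)%N -> g (t + l)%N <= (1 - delta / sigma) ^+ l * g t.
  elim: l => [|l IH]; first by rewrite addn0 mul1r.
  rewrite addnS => lt; apply: le_trans (gS _ lt) _.
  by rewrite exprS -mulrA ler_wpM2l // IH // ltnW.
have leaves t : (t <= T)%N -> exists2 j, j \in bset (Bs t) &
    forall t', (t + L <= t' < T)%N -> j \notin bset (Bs t').
  move=> leT; have [j jB jout] := variable_elimination stBo (bfsT _ leT).
  exists j => // t' /andP[Lt' t'T]; apply: jout; first exact: bfsT (ltnW _).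
  rewrite -/(g t) -/(g t'); have tt' : (t + (t' - t) = t')%N.
    by rewrite subnKC // (leq_trans _ Lt') // leq_addr.
  have Lle : (L <= t' - t)%N by rewrite -(leq_add2l t) tt'.
  have tT : (t < T)%N by rewrite (leq_ltn_trans _ t'T) // -tt' leq_addr.
  have := gD t (t' - t)%N; rewrite tt' => /(_ (ltnW t'T)) gt'.
  have a_gt0 : 0 < m%:R * sigma / delta by rewrite divr_gt0 // mulr_gt0 // ltr0n.
  apply: (@le_lt_trans _ _
      ((1 - delta / sigma) ^+ L * g t * (m%:R * sigma / delta))).
    rewrite ler_wpM2r // ?(ltW a_gt0) // (le_trans gt') //.
    rewrite ler_wpM2r ?(ltW (g_gt0 _ tT)) //.
    exact: ler_wiXn2l.
  rewrite mulrAC -[X in _ < X]mul1r ltr_pM2r ?g_gt0 //.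
  exact: pow_contraction.
have iT (i : 'I_n.+1) : (i * L < T)%N.
  by rewrite (leq_ltn_trans _ ltT) // leq_mul2r -ltnS ltn_ord orbT.
(* J picks, for each i <= n, an index that is basic at iterate i * L and
   nonbasic at the later multiples of L. *)
pose J (i : 'I_n.+1) := s2val (cid2 (leaves (i * L)%N (ltnW (iT i)))).
have JP i i' : J i = J i' -> (i' <= i)%N.
  move=> eqJ; rewrite leqNgt; apply/negP => lt.
  have Jin : J i' \in bset (Bs (i' * L)%N) by rewrite /J; case: cid2.
  suff: J i \notin bset (Bs (i' * L)%N) by rewrite eqJ Jin.
  rewrite /J; case: cid2 => j _ /= jout; apply: jout.
  by rewrite iT andbT -mulSnr leq_mul2r lt orbT.
have injJ : injective J.
  by move=> i i' eqJ; apply/val_inj/eqP; rewrite eqn_leq !JP.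
by have := leq_card J injJ; rewrite !card_ord ltnn.
Qed.

End IterationBound.

(** * Markov decision problems with two actions *)

(** Column j of the constraint matrix stands for an action in this state. *)
Definition state m (j : 'I_(m + m)) : 'I_m :=
  match split j with inl i => i | inr i => i end.

Section Markov.

Variables (R : realFieldType) (m : nat) (theta : R).
Hypotheses (theta_ge0 : 0 <= theta) (theta_lt1 : theta < 1).
Variables P1 P2 : 'M[R]_m.
Hypotheses (markov_P1 : markov P1) (markov_P2 : markov P2).

Let A := mdp_mx theta P1 P2.

Lemma mdp_mxE i j : A i j = (i == state j)%:R - theta * row_mx P1 P2 i j.
Proof. by rewrite /A /state !mxE; case: splitP => k _; rewrite !mxE. Qed.

Lemma row_mx_markov : (forall i j, 0 <= row_mx P1 P2 i j) /\
  (forall j, \sum_i row_mx P1 P2 i j = 1).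
Proof.
have [P1ge P1s] := markov_P1; have [P2ge P2s] := markov_P2.
split=> [i j|j]; first by rewrite mxE; case: splitP.
under eq_bigr do rewrite mxE.
by case: (split j) => k; [exact: P1s | exact: P2s].
Qed.

(** Summing the m constraints gives (1 - theta) times the sum of the entries,
    as the columns of P1 and P2 sum to 1. *)
Lemma mdp_feasible_sum (y : 'cV[R]_(m + m)) :
  A *m y = const_mx 1 -> \sum_j y j 0 = m%:R / (1 - theta).
Proof.
move=> Ay; have t0 : 1 - theta != 0 by rewrite subr_eq0 eq_sym lt_eqF.
apply: (canRL (mulfK t0)).
have -> : m%:R = \sum_(i < m) (A *m y) i 0.
  under eq_bigr do rewrite Ay mxE.
  by rewrite sumr_const card_ord.
under [RHS]eq_bigr do rewrite mxE.
rewrite exchange_big mulr_suml; apply: eq_bigr => j _.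
rewrite -mulr_suml mulrC; congr (_ * _).
under eq_bigr do rewrite mdp_mxE.
rewrite sumrB -mulr_sumr (row_mx_markov.2 j) mulr1; congr (_ - _).
by rewrite (bigD1 (state j)) //= eqxx big1 ?addr0 // => i /negbTE ->.
Qed.

Lemma mdp_feasible_state y i : feasible A (const_mx 1) y ->
  1 <= \sum_(j | state j == i) y j 0.
Proof.
case=> Ay y0; move/colP/(_ i): (Ay); rewrite !mxE.
under eq_bigr do rewrite mdp_mxE mulrBl.
rewrite sumrB => /(canRL (subrK _)) e.
have -> : \sum_(j | state j == i) y j 0 = \sum_j (i == state j)%:R * y j 0.
  rewrite big_mkcond; apply: eq_bigr => j _; rewrite eq_sym.
  by case: eqP; rewrite ?mul1r ?mul0r.
rewrite e lerDl sumr_ge0 // => j _.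
by rewrite !mulr_ge0 // row_mx_markov.1.
Qed.

(** The m basic variables must cover the m states, so the state map is injective
    on the basis; the sum over the state of a basic variable then reduces to
    this variable. *)
Lemma mdp_basic_ge1 (B : basis A) : bfs_basis (const_mx 1) B ->
  forall j, j \in bset B -> 1 <= basic_sol (const_mx 1) B j 0.
Proof.
move=> bfsB; have fB := bfs_feasible bfsB.
have onto i : exists k, state (bidx B k) = i.
  apply: contrapT => nex; have := mdp_feasible_state i fB.
  rewrite big1 ?ler10 // => j /eqP ji; apply: basic_sol_nonbasic.
  apply/negP => /(set_index_ex (bcard B))[k kj]; apply: nex.
  by exists k; rewrite /bidx kj.
pose h i := sval (cid (onto i)).
pose f k := state (bidx B k).
have hK : cancel h f by move=> i; exact: (svalP (cid (onto i))).
have injf : injective f.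
  by apply: bij_inj; exact: (bij_can_bij (injF_bij (can_inj hK)) hK).
move=> _ /(set_index_ex (bcard B))[k <-]; rewrite -/(bidx B k).
apply: le_trans (mdp_feasible_state (state (bidx B k)) fB) _.
rewrite (bigD1 (bidx B k)) //= big1 ?addr0 // => j /andP[/eqP js jk].
apply: basic_sol_nonbasic; apply/negP => /(set_index_ex (bcard B))[l lj].
case/negP: jk; rewrite -lj -/(bidx B l) in js *; apply/eqP.
by congr (bidx B _); apply: injf.
Qed.

End Markov.

Unset Implicit Arguments.

Theorem corollary4p2 (R : realType) (m : nat) (m_gt0 : (0 < m)%N)
    (theta : R) (theta_ge0 : 0 <= theta) (theta_lt1 : theta < 1)
    (P1 P2 : 'M[R]_m) (markov_P1 : markov P1) (markov_P2 : markov P2)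
    (c1 c2 : 'cV[R]_m) (rule : pivot_rule)
    (Bs : nat -> basis (mdp_mx theta P1 P2)) (T : nat)
    (run : simplex_run rule (const_mx 1) (col_mx c1 c2) Bs T) :
  [/\ (T%:Z <= (2 * m)%:Z * strict_ceil (m%:R ^+ 2 / (1 - theta)
                                         * ln (m%:R ^+ 2 / (1 - theta)))),
      stopped (col_mx c1 c2) (Bs T) ->
        optimal (mdp_mx theta P1 P2) (const_mx 1) (col_mx c1 c2)
          (basic_sol (const_mx 1) (Bs T))
    & ~ stopped (col_mx c1 c2) (Bs T) ->
        exists B', simplex_step rule (const_mx 1) (col_mx c1 c2) (Bs T) B'].
Proof.
have sum_le y : feasible (mdp_mx theta P1 P2) (const_mx 1) y ->
    \sum_j y j 0 <= m%:R / (1 - theta).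
  by case=> Ay _; rewrite (mdp_feasible_sum theta_lt1 markov_P1 markov_P2 Ay).
have basic_ge := @mdp_basic_ge1 _ _ _ theta_ge0 _ _ markov_P1 markov_P2.
have bfsT := simplex_run_bfs run (leqnn T).
split; last 2 first.
- exact: stopped_optimal.
- exact: simplex_step_exists sum_le _ bfsT.
set a := m%:R ^+ 2 / (1 - theta).
have a_ge1 : 1 <= a.
  rewrite ler_pdivlMr ?subr_gt0 // mul1r.
  apply: (@le_trans _ _ 1); first by rewrite gerBl.
  by rewrite expr_ge1 ?ler1n.
(* The bound is a natural number because ln a >= 0. *)
have L_ge0 : 0 <= strict_ceil (a * ln a).
  by rewrite addr_ge0 // floor_ge0 mulr_ge0 ?ln_ge0 // (le_trans ler01).
have [L LE] : exists L : nat, strict_ceil (a * ln a) = L%:Z.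
  by exists `|strict_ceil (a * ln a)|%N; rewrite gez0_abs.
rewrite LE -PoszM lez_nat mul2n -addnn.
apply: (simplex_iteration_bound m_gt0 ltr01 sum_le basic_ge run).
have -> : m%:R * (m%:R / (1 - theta)) / 1 = a by rewrite divr1 mulrA.
have -> : L%:R = (strict_ceil (a * ln a))%:~R :> R by rewrite LE.
exact: floorD1_gt.
Qed.
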